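(* Let $0<\theta<2\pi$ and $\beta\in\mathbb{C}\setminus\mathbb{Z}_{\ge 0}$. For $|\alpha|<1$ let $I(\alpha)=\int_{\partial\mathbb{D}}\frac{e^{\beta\log_\theta(z)}}{z-\alpha}\,dz$. Then, on $|\alpha|<1$, $I$ solves the differential equation $$r_2(\alpha)\frac{d^2I}{d\alpha^2}+r_1(\alpha)\frac{dI}{d\alpha}+\beta I=0,$$ where $r_2(\alpha)=\alpha^2-\alpha e^{i\theta}$ and $r_1(\alpha)=(1-\beta)e^{i\theta}-(2-\beta)\alpha$. Moreover, the regular singular points of this equation are $0$, $e^{i\theta}$ and $\infty$.
   Context: For $0<\theta<2\pi$, $\log_\theta$ is the branch of the complex logarithm on $\mathbb{C}\setminus\{re^{i\theta}:r\ge 0\}$ with $\log_\theta(1)=0$, that is, $\log_\theta(z)=\ln|z|+i\arg_\theta(z)$ with $\arg_\theta(z)\in(\theta-2\pi,\theta)$. $\partial\mathbb{D}$ is the unit circle traversed counterclockwise, and $I(\alpha)=\int_{\theta-2\pi}^{\theta}\frac{e^{i\beta t}}{e^{it}-\alpha}\,ie^{it}\,dt$. A finite point $a$ is a regular singular point of $P_2y''+P_1y'+P_0y=0$ if $P_1/P_2$ or $P_0/P_2$ has a pole at $a$ while $(\alpha-a)P_1/P_2$ and $(\alpha-a)^2P_0/P_2$ are analytic near $a$; $\infty$ is a regular singular point if $x=0$ is one after the substitution $x=1/\alpha$.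
   Formalization: The sign of r_2 is corrected: the formal statement uses r_2(α) = αe^{iθ} − α² instead of α² − αe^{iθ}; with the printed sign the differential equation fails for every non-integer β (e.g. β = 1/2, θ = π), already at first order in α. *)

(* Defs.v *)
From Stdlib Require Import Reals.
From Coquelicot Require Import Coquelicot.
Open Scope C_scope.

Definition Cexp (z : C) : C :=
  ((exp (Re z) * cos (Im z))%R, (exp (Re z) * sin (Im z))%R).

(** [iota] is meaningful only when the described number exists and is unique,
    that is, off the cut [{r e^(i theta) : r >= 0}]; on the cut the value is
    arbitrary. *)
Definition arg_branch (theta : R) (z : C) : R :=
  iota (T := R_CompleteNormedModule) (fun t : R =>
    (theta - 2 * PI < t < theta)%R /\ z = Cmod z * Cexp (Ci * t)).

Definition log_branch (theta : R) (z : C) : C :=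
  ln (Cmod z) + Ci * arg_branch theta z.

(** Integral over the unit circle, counterclockwise, parametrised by
    [z = e^(i t)] for [theta - 2 PI <= t <= theta]. The circle is thus cut open
    where it meets the branch cut of [log_branch theta], which it reaches only
    at the two endpoints; these do not affect the Riemann integral. *)
Definition unit_circle_int (theta : R) (f : C -> C) : C :=
  RInt (V := C_R_CompleteNormedModule)
    (fun t : R => f (Cexp (Ci * t)) * (Ci * Cexp (Ci * t)))
    (theta - 2 * PI)%R theta.

Definition cauchy_power_int (theta : R) (beta alpha : C) : C :=
  unit_circle_int theta
    (fun z => Cexp (beta * log_branch theta z) / (z - alpha)).

(** [f] solves [P2 y'' + P1 y' + P0 y = 0] on [D], derivatives being complex. *)
Definition solves_on (D : C -> Prop) (P2 P1 P0 f : C -> C) : Prop :=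
  forall z : C, D z ->
    ex_derive (K := C_AbsRing) (V := C_NormedModule) f z /\
    ex_derive (K := C_AbsRing) (V := C_NormedModule) (C_derive f) z /\
    P2 z * C_derive (C_derive f) z + P1 z * C_derive f z + P0 z * f z = 0.

Definition analytic_at (f : C -> C) (a : C) : Prop :=
  exists c : nat -> C, locally a (fun z : C =>
    is_pseries (K := C_AbsRing) (V := C_NormedModule) c (z - a) (f z)).

(** [f] is analytic near [a], up to its value at [a]: the coefficient quotients
    below are not defined at the zeros of the leading coefficient. *)
Definition analytic_near (f : C -> C) (a : C) : Prop :=
  exists g : C -> C, analytic_at g a /\ locally' a (fun z : C => f z = g z).

Definition has_pole (f : C -> C) (a : C) : Prop :=
  exists (n : nat) (g : C -> C), (0 < n)%nat /\ analytic_at g a /\ g a <> 0 /\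
    locally' a (fun z : C => f z = g z / (z - a) ^ n).

Definition finite_regular_singular (P2 P1 P0 : C -> C) (a : C) : Prop :=
  (has_pole (fun z => P1 z / P2 z) a \/ has_pole (fun z => P0 z / P2 z) a) /\
  analytic_near (fun z => (z - a) * (P1 z / P2 z)) a /\
  analytic_near (fun z => (z - a) ^ 2 * (P0 z / P2 z)) a.

(** With [y(alpha) = u(x)] and [x = 1 / alpha] one has [y' = - x^2 u'] and
    [y'' = x^4 u'' + 2 x^3 u'], so [P2 y'' + P1 y' + P0 y = 0] becomes
    [x^4 P2(1/x) u'' + (2 x^3 P2(1/x) - x^2 P1(1/x)) u' + P0(1/x) u = 0]. *)
Definition infinity_regular_singular (P2 P1 P0 : C -> C) : Prop :=
  finite_regular_singular
    (fun x => x ^ 4 * P2 (/ x))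
    (fun x => 2 * x ^ 3 * P2 (/ x) - x ^ 2 * P1 (/ x))
    (fun x => P0 (/ x))
    0.

(** Points of the Riemann sphere are elements of [option C], with [None] the
    point at infinity. *)
Definition regular_singular (P2 P1 P0 : C -> C) (p : option C) : Prop :=
  match p with
  | Some a => finite_regular_singular P2 P1 P0 a
  | None => infinity_regular_singular P2 P1 P0
  end.

(** The sign matters. Expanding at [0], the integral is a constant multiple of
    [sum_n (alpha e^(-i theta))^n / (beta - n)], and with the opposite sign
    [alpha^2 - alpha e^(i theta)] (and [r1] as below) the differential equation
    fails for every non-integer [beta], already at order one in [alpha]. *)
Definition r2 (theta : R) (alpha : C) : C :=
  alpha * Cexp (Ci * theta) - alpha ^ 2.

Definition r1 (theta : R) (beta alpha : C) : C :=
  (1 - beta) * Cexp (Ci * theta) - (2 - beta) * alpha.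

(* Main.v *)
Require Import Defs.
From Stdlib Require Import Reals.
From Coquelicot Require Import Coquelicot.
From Stdlib Require Import Lra Lia.
Open Scope C_scope.

(** On the circle, inside the cut, [log_theta (e ^ (i t)) = i t], so the integral
    is the Cauchy integral of the smooth density [z ^ beta dz/dt] over the
    parameter interval [[theta - 2 PI, theta]] ([cauchy_power_int_moment]). A
    uniform second-order estimate of [1 / (z - alpha) ^ k] allows differentiation
    under the integral sign ([is_derive_cauchy_moment]), so that [I'] and [I'']
    are the integrals of [z ^ beta / (z - alpha) ^ 2] and
    [2 z ^ beta / (z - alpha) ^ 3].

    The left-hand side of the differential equation is therefore the integral of
    a combination of these kernels, and that combination is an exact derivative:
    with [c = e ^ (i theta)],
    [d/dz (z ^ (beta + 1) (z - c) / (z - alpha) ^ 2)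
       = z ^ beta (2 r2 / (z - alpha) ^ 3 + r1 / (z - alpha) ^ 2
                   + beta / (z - alpha))]
    ([is_derive_power_primitive]). Both ends of the path are [z = c], where the
    primitive vanishes, so the integral is zero ([cauchy_moment_ode]).

    For the singular points, the quotients [r1 / r2] and [beta / r2] have simple
    poles at most at [0] and [c], and near any other point they are bounded,
    which excludes a pole ([bounded_not_has_pole]). At [0], [c] and, in the
    coordinate [1 / alpha], infinity, the quotient [beta / r2] does have a pole
    because [beta <> 0], and after multiplication by the allowed powers each
    quotient takes the form [A + B / (d - z)] with [d] another point, analytic by
    the geometric series ([analytic_at_moebius]). *)

(** * Complex-valued functions of a real variable *)

(** Differentiating a curve in [C] amounts to differentiating its two real
    coordinates; this reduces the product and inverse rules below to real
    calculus. *)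
Lemma is_derive_C_components (f : R -> C) (x : R) (l : C) :
  is_derive (V := C_R_NormedModule) f x l <->
  is_derive (fun t => fst (f t)) x (fst l) /\
  is_derive (fun t => snd (f t)) x (snd l).
Proof.
split.
- intros H; split.
  + exact (filterdiff_comp' f (fun p : R * R => fst p) x _ _ H
      (filterdiff_linear _ is_linear_fst)).
  + exact (filterdiff_comp' f (fun p : R * R => snd p) x _ _ H
      (filterdiff_linear _ is_linear_snd)).
- intros [H1 H2].
  apply (is_derive_ext
    (fun t => plus (scal (fst (f t)) ((1, 0)%R : C_R_NormedModule))
                   (scal (snd (f t)) ((0, 1)%R : C_R_NormedModule)))).
  + intros t; destruct (f t) as [u v]; cbv [plus scal]; simpl.
    cbv [prod_plus prod_scal scal mult plus]; simpl; f_equal; cbv [mult plus]; simpl; ring.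
  + replace l with (plus (scal (fst l) ((1, 0)%R : C_R_NormedModule))
                   (scal (snd l) ((0, 1)%R : C_R_NormedModule))).
    * apply @is_derive_plus.
      -- exact (is_derive_scal_l (V := C_R_NormedModule) _ _ _ (1, 0)%R H1).
      -- exact (is_derive_scal_l (V := C_R_NormedModule) _ _ _ (0, 1)%R H2).
    * destruct l as [u v]; cbv [plus scal]; simpl.
      cbv [prod_plus prod_scal scal mult plus]; simpl; f_equal; cbv [mult plus]; simpl; ring.
Qed.

Lemma is_derive_C_mult (f g : R -> C) (x : R) (f' g' : C) :
  is_derive (V := C_R_NormedModule) f x f' ->
  is_derive (V := C_R_NormedModule) g x g' ->
  is_derive (V := C_R_NormedModule) (fun t => f t * g t) x (f' * g x + f x * g').
Proof.
rewrite !is_derive_C_components; simpl.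
intros [Hf1 Hf2] [Hg1 Hg2].
set (f1 := fun t => fst (f t)) in *; set (f2 := fun t => snd (f t)) in *.
set (g1 := fun t => fst (g t)) in *; set (g2 := fun t => snd (g t)) in *.
split.
- change (is_derive (fun t => f1 t * g1 t - f2 t * g2 t)%R x
    ((fst f' * g1 x - snd f' * g2 x) + (f1 x * fst g' - f2 x * snd g'))%R).
  auto_derive.
  + repeat split; eexists; eassumption.
  + rewrite (is_derive_unique (fun t : R => f1 t) _ _ Hf1), (is_derive_unique (fun t : R => f2 t) _ _ Hf2),
      (is_derive_unique (fun t : R => g1 t) _ _ Hg1), (is_derive_unique (fun t : R => g2 t) _ _ Hg2); ring.
- change (is_derive (fun t => f1 t * g2 t + f2 t * g1 t)%R x
    ((fst f' * g2 x + snd f' * g1 x) + (f1 x * snd g' + f2 x * fst g'))%R).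
  auto_derive.
  + repeat split; eexists; eassumption.
  + rewrite (is_derive_unique (fun t : R => f1 t) _ _ Hf1), (is_derive_unique (fun t : R => f2 t) _ _ Hf2),
      (is_derive_unique (fun t : R => g1 t) _ _ Hg1), (is_derive_unique (fun t : R => g2 t) _ _ Hg2); ring.
Qed.

Lemma ex_derive_C_mult (f g : R -> C) (x : R) :
  ex_derive (V := C_R_NormedModule) f x -> ex_derive (V := C_R_NormedModule) g x ->
  ex_derive (V := C_R_NormedModule) (fun t => f t * g t) x.
Proof. intros [f' Hf] [g' Hg]; eexists; apply is_derive_C_mult; eassumption. Qed.

Lemma Cmod2_pos (z : C) : z <> 0 -> (0 < fst z ^ 2 + snd z ^ 2)%R.
Proof.
intros Hz; apply Cmod_gt_0 in Hz.
pose proof (Cmod2_alt z) as E; unfold Re, Im in E.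
rewrite <- E; apply pow_lt, Hz.
Qed.

Lemma is_derive_C_inv (f : R -> C) (x : R) (f' : C) :
  f x <> 0 ->
  is_derive (V := C_R_NormedModule) f x f' ->
  is_derive (V := C_R_NormedModule) (fun t => / f t) x (- f' * (/ f x) ^ 2).
Proof.
rewrite !is_derive_C_components; simpl.
intros Hz%Cmod2_pos [Hf1 Hf2].
set (f1 := fun t => fst (f t)) in *; set (f2 := fun t => snd (f t)) in *.
change (0 < f1 x ^ 2 + f2 x ^ 2)%R in Hz; split.
- apply (is_derive_ext (fun t => f1 t / (f1 t ^ 2 + f2 t ^ 2))%R);
    [ reflexivity | ].
  auto_derive.
  + repeat split; try (eexists; eassumption); simpl in Hz; lra.
  + rewrite (is_derive_unique (fun t : R => f1 t) _ _ Hf1), (is_derive_unique (fun t : R => f2 t) _ _ Hf2).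
    fold (f1 x) (f2 x); field; simpl in Hz; lra.
- apply (is_derive_ext (fun t => - f2 t / (f1 t ^ 2 + f2 t ^ 2))%R);
    [ reflexivity | ].
  auto_derive.
  + repeat split; try (eexists; eassumption); simpl in Hz; lra.
  + rewrite (is_derive_unique (fun t : R => f1 t) _ _ Hf1), (is_derive_unique (fun t : R => f2 t) _ _ Hf2).
    fold (f1 x) (f2 x); field; simpl in Hz; lra.
Qed.

Lemma is_derive_Cexp_linear (c : C) (x : R) :
  is_derive (V := C_R_NormedModule) (fun t : R => Cexp (c * t)) x (c * Cexp (c * x)).
Proof.
apply is_derive_C_components; destruct c as [a b]; unfold Cexp; simpl; split; auto_derive; auto;
  unfold Rminus; ring.
Qed.

(** The integral is that of a real vector space, so linearity over complex
    scalars is checked on real and imaginary parts. *)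
Lemma is_RInt_C_scal (c : C) (f : R -> C) (a b : R) (l : C) :
  is_RInt (V := C_R_NormedModule) f a b l ->
  is_RInt (V := C_R_NormedModule) (fun t => c * f t) a b (c * l).
Proof.
intros H.
pose proof (is_RInt_fct_extend_fst _ _ _ _ H) as H1.
pose proof (is_RInt_fct_extend_snd _ _ _ _ H) as H2.
apply is_RInt_fct_extend_pair; simpl.
- exact (is_RInt_minus _ _ _ _ _ _ (is_RInt_scal _ _ _ (fst c) _ H1)
    (is_RInt_scal _ _ _ (snd c) _ H2)).
- exact (is_RInt_plus _ _ _ _ _ _ (is_RInt_scal _ _ _ (fst c) _ H2)
    (is_RInt_scal _ _ _ (snd c) _ H1)).
Qed.

(** * The unit circle and powers of the Cauchy kernel *)

Lemma Cexp_0 : Cexp 0 = 1.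
Proof. unfold Cexp; simpl; rewrite exp_0, cos_0, sin_0; apply injective_projections; simpl; ring. Qed.

Lemma Cexp_add (u v : C) : Cexp (u + v) = Cexp u * Cexp v.
Proof.
destruct u as [a b], v as [c d]; unfold Cexp; simpl.
rewrite exp_plus, cos_plus, sin_plus; apply injective_projections; simpl; ring.
Qed.

Lemma Cmod_Cexp_Ci (t : R) : Cmod (Cexp (Ci * t)) = 1%R.
Proof.
unfold Cmod, Cexp; simpl.
replace (0 * t - 1 * 0)%R with 0%R by ring; rewrite exp_0.
replace (0 * 0 + 1 * t)%R with t by ring.
pose proof (sin2_cos2 t) as E; unfold Rsqr in E.
transitivity (sqrt (sin t * sin t + cos t * cos t)); [ f_equal; ring | ].
rewrite E; apply sqrt_1.
Qed.

Lemma Cmod_le_sub_add (y z : C) : (Cmod y <= Cmod (y - z) + Cmod z)%R.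
Proof.
replace y with (y - z + z) at 1 by ring; apply Cmod_triangle.
Qed.

(** On the open disk the Cauchy kernel stays bounded, uniformly in the point of
    the circle. *)
Lemma Cmod_circle_sub (alpha : C) (t : R) :
  (1 - Cmod alpha <= Cmod (Cexp (Ci * t) - alpha))%R.
Proof.
pose proof (Cmod_le_sub_add (Cexp (Ci * t)) alpha) as E.
rewrite Cmod_Cexp_Ci in E; lra.
Qed.

Lemma circle_sub_neq_0 (alpha : C) (t : R) :
  (Cmod alpha < 1)%R -> Cexp (Ci * t) - alpha <> 0.
Proof.
intros H; apply Cmod_gt_0; pose proof (Cmod_circle_sub alpha t); lra.
Qed.

(** The second-order Taylor estimate for [x ^ (- k)] at [u], uniform in the
    region where inverses are bounded by [B]. It rests on
    [1/v - 1/u = (u - v) / (v u)] alone, by induction on [k]: the remainder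
    [E_k] satisfies [E_(k+1) = E_k / v + (k+1) (u - v)^2 / (v u^(k+2))], and the
    constants [k (k+1) / 2 * B ^ (k+2)] solve the resulting recurrence. *)
Lemma Cmod_inv_pow_taylor (u v : C) (B : R) (k : nat) :
  u <> 0 -> v <> 0 -> (Cmod (/ u) <= B)%R -> (Cmod (/ v) <= B)%R ->
  (Cmod ((/ v) ^ k - (/ u) ^ k - INR k * (u - v) * (/ u) ^ S k) <=
   INR k * (INR k + 1) / 2 * B ^ (k + 2) * Cmod (u - v) ^ 2)%R.
Proof.
intros Hu Hv Bu Bv.
assert (HB : (0 <= B)%R) by (eapply Rle_trans; [ apply Cmod_ge_0 | exact Bu ]).
set (p := / v) in *; set (q := / u) in *; set (h := u - v).
assert (Epq : p - q = h * p * q) by (unfold p, q, h; field; auto).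
clearbody h; induction k as [|k IH].
- simpl; replace (1 - 1 - 0 * h * (q * 1)) with (RtoC 0) by ring.
  rewrite Cmod_0; lra.
- set (E := p ^ k - q ^ k - INR k * h * q ^ S k) in IH.
  replace (p ^ S k - q ^ S k - INR (S k) * h * q ^ S (S k))
    with (p * E + INR (S k) * h ^ 2 * p * q ^ (k + 2)).
  + eapply Rle_trans; [ apply Cmod_triangle | ].
    rewrite !Cmod_mult, !Cmod_pow, Cmod_R, (Rabs_right (INR (S k)))
      by (apply Rle_ge, pos_INR).
    assert (H1 : (Cmod p * Cmod E <=
      B * (INR k * (INR k + 1) / 2 * B ^ (k + 2) * Cmod h ^ 2))%R).
    { apply Rmult_le_compat; auto using Cmod_ge_0. }
    assert (H2 : (INR (S k) * Cmod h ^ 2 * Cmod p * Cmod q ^ (k + 2) <=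
      INR (S k) * Cmod h ^ 2 * B * B ^ (k + 2))%R).
    { assert (0 <= INR (S k) * Cmod h ^ 2)%R
        by (apply Rmult_le_pos; [ apply pos_INR | apply pow_le, Cmod_ge_0 ]).
      apply Rmult_le_compat.
      - apply Rmult_le_pos; auto using Cmod_ge_0.
      - apply pow_le, Cmod_ge_0.
      - apply Rmult_le_compat_l; auto.
      - apply pow_incr; split; auto using Cmod_ge_0. }
    eapply Rle_trans; [ apply Rplus_le_compat; eassumption | ].
    rewrite S_INR; replace (S k + 2)%nat with (S (k + 2)) by lia; simpl (B ^ S (k + 2))%R.
    right; field.
  + assert (Ep : p = q + h * p * q) by (rewrite <- Epq; ring).
    rewrite S_INR, RtoC_plus.
    unfold E; rewrite Cpow_add_r; simpl Cpow.
    transitivity (p * p ^ k - q * q ^ k - (INR k + 1) * h * (q * (q * q ^ k))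
      + q ^ k * (h * p * q - (p - q)) + (INR k + 1) * h * q ^ k * q * (h * p * q - (p - q)));
      [ | rewrite Epq ]; ring.
Qed.

(** * Cauchy integrals and their complex derivatives *)

(** Up to the factor [(k-1)!], the derivative of order [k - 1] of the Cauchy
    integral of the density [w]. *)
Definition cauchy_moment (a b : R) (w : R -> C) (k : nat) (alpha : C) : C :=
  RInt (V := C_R_CompleteNormedModule)
    (fun t => w t * (/ (Cexp (Ci * t) - alpha)) ^ k) a b.

Lemma is_derive_circle_inv (alpha : C) (t : R) :
  (Cmod alpha < 1)%R ->
  is_derive (V := C_R_NormedModule) (fun s : R => / (Cexp (Ci * s) - alpha)) t
    (- (Ci * Cexp (Ci * t)) * (/ (Cexp (Ci * t) - alpha)) ^ 2).
Proof.
intros Ha; apply (is_derive_C_inv (fun s : R => Cexp (Ci * s) - alpha)).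
- now apply circle_sub_neq_0.
- replace (Ci * Cexp (Ci * t)) with (Ci * Cexp (Ci * t) - 0) by ring.
  apply @is_derive_minus; [ apply is_derive_Cexp_linear | apply @is_derive_const ].
Qed.

Lemma ex_derive_circle_inv_pow (alpha : C) (k : nat) (t : R) :
  (Cmod alpha < 1)%R ->
  ex_derive (V := C_R_NormedModule)
    (fun s : R => (/ (Cexp (Ci * s) - alpha)) ^ k) t.
Proof.
intros Ha; induction k as [|k IH]; simpl.
- apply @ex_derive_const.
- apply ex_derive_C_mult; [ eexists; now apply is_derive_circle_inv | exact IH ].
Qed.

Lemma is_RInt_cauchy_moment (a b : R) (w : R -> C) (k : nat) (alpha : C) :
  (forall t, ex_derive (V := C_R_NormedModule) w t) -> (Cmod alpha < 1)%R ->
  is_RInt (V := C_R_NormedModule)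
    (fun t : R => w t * (/ (Cexp (Ci * t) - alpha)) ^ k) a b
    (cauchy_moment a b w k alpha).
Proof.
intros Hw Ha; apply (RInt_correct (V := C_R_CompleteNormedModule)).
apply (ex_RInt_continuous (V := C_R_CompleteNormedModule)); intros t _.
apply (ex_derive_continuous (V := C_R_NormedModule)), ex_derive_C_mult; auto.
now apply ex_derive_circle_inv_pow.
Qed.

Lemma ex_RInt_Cmod (a b : R) (w : R -> C) :
  (forall t, ex_derive (V := C_R_NormedModule) w t) ->
  ex_RInt (fun t => Cmod (w t)) a b.
Proof.
intros Hw; apply (ex_RInt_continuous (V := R_CompleteNormedModule)); intros t _.
apply (continuous_ext (fun t => norm (w t : C_R_NormedModule))).
- intros s; symmetry; apply Cmod_norm.
- apply (continuous_comp (V := C_R_NormedModule) w norm).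
  + now apply (ex_derive_continuous (V := C_R_NormedModule)).
  + apply (filterlim_norm (V := C_R_NormedModule)).
Qed.

(** Differentiation under the integral sign. Subtracting the candidate
    derivative inside the integral leaves the Taylor remainder of the kernel,
    which is [O (|y - alpha| ^ 2)] uniformly on the circle; integrating against
    [|w|] keeps it quadratic. *)
Lemma is_derive_cauchy_moment (a b : R) (w : R -> C) (k : nat) (alpha : C) :
  (a <= b)%R -> (forall t, ex_derive (V := C_R_NormedModule) w t) ->
  (Cmod alpha < 1)%R ->
  is_derive (K := C_AbsRing) (V := C_NormedModule)
    (cauchy_moment a b w k) alpha (INR k * cauchy_moment a b w (S k) alpha).
Proof.
intros Hab Hw Ha.
destruct (ex_RInt_Cmod a b w Hw) as [L HL].
(* Every point [y] within [d] of [alpha], and [alpha] itself, is at distance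
   at least [d] from the circle. *)
set (d := ((1 - Cmod alpha) / 2)%R).
assert (Hd : (0 < d)%R) by (unfold d; lra).
set (K := (INR k * (INR k + 1) / 2 * (/ d) ^ (k + 2))%R).
assert (HK : (0 <= K)%R).
{ unfold K; pose proof (pos_INR k); apply Rmult_le_pos.
  - apply Rmult_le_pos; [ apply Rmult_le_pos | ]; lra.
  - apply pow_le, Rlt_le, Rinv_0_lt_compat, Hd. }
assert (HL0 : (0 <= L)%R).
{ rewrite <- (is_RInt_unique _ _ _ _ HL); apply RInt_ge_0; auto.
  - now exists L.
  - intros; apply Cmod_ge_0. }
assert (Hquad : forall y, (Cmod (y - alpha) < d)%R ->
  (Cmod (cauchy_moment a b w k y - cauchy_moment a b w k alpha
     - (y - alpha) * (INR k * cauchy_moment a b w (S k) alpha))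
   <= L * (K * Cmod (y - alpha) ^ 2))%R).
{ intros y Hy.
  assert (Hy1 : (Cmod y + d < 1)%R).
  { pose proof (Cmod_le_sub_add y alpha); unfold d in *; lra. }
  assert (Hinv : forall z (t : R), (Cmod z + d <= 1)%R ->
    (Cmod (/ (Cexp (Ci * t) - z)) <= / d)%R).
  { intros z t Hz; rewrite Cmod_inv by (apply circle_sub_neq_0; lra).
    apply Rinv_le_contravar; auto.
    pose proof (Cmod_circle_sub z t); lra. }
  rewrite (Cmod_norm (_ - _)).
  eapply (norm_RInt_le (V := C_R_NormedModule)
    (fun t : R => w t * (/ (Cexp (Ci * t) - y)) ^ k
       - w t * (/ (Cexp (Ci * t) - alpha)) ^ k
       - (y - alpha) * (INR k * (w t * (/ (Cexp (Ci * t) - alpha)) ^ S k)))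
    (fun t => Cmod (w t) * (K * Cmod (y - alpha) ^ 2))%R a b); auto.
  - intros t _; rewrite <- Cmod_norm.
    set (u := Cexp (Ci * t) - alpha); set (v := Cexp (Ci * t) - y).
    replace (y - alpha) with (u - v) by (unfold u, v; ring).
    replace (w t * (/ v) ^ k - w t * (/ u) ^ k
      - (u - v) * (INR k * (w t * (/ u) ^ S k)))
      with (w t * ((/ v) ^ k - (/ u) ^ k - INR k * (u - v) * (/ u) ^ S k)) by ring.
    rewrite Cmod_mult; apply Rmult_le_compat_l; [ apply Cmod_ge_0 | ].
    apply Cmod_inv_pow_taylor;
      [ apply circle_sub_neq_0 | apply circle_sub_neq_0 | apply Hinv | apply Hinv ];
      unfold d in *; lra.
  - apply @is_RInt_minus; [ apply @is_RInt_minus | ].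
    + apply is_RInt_cauchy_moment; auto; lra.
    + now apply is_RInt_cauchy_moment.
    + now apply is_RInt_C_scal, is_RInt_C_scal, is_RInt_cauchy_moment.
  - apply (is_RInt_ext (fun t => scal (K * Cmod (y - alpha) ^ 2)%R (Cmod (w t)))).
    + intros t _; cbv [scal]; simpl; cbv [mult]; simpl; ring.
    + replace (L * (K * Cmod (y - alpha) ^ 2))%R
        with (scal (K * Cmod (y - alpha) ^ 2)%R L)
        by (cbv [scal]; simpl; cbv [mult]; simpl; ring).
      now apply @is_RInt_scal. }
split; [ apply @is_linear_scal_l | ].
intros x Hx.
apply (is_filter_lim_locally_unique (V := AbsRing_NormedModule C_AbsRing)) in Hx; subst x.
intros eps.
assert (HLK : (0 < L * K + 1)%R) by (pose proof (Rmult_le_pos _ _ HL0 HK); lra).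
assert (Hr : (0 < Rmin d (eps / (L * K + 1)))%R).
{ apply Rmin_pos; auto; apply Rdiv_lt_0_compat; [ apply cond_pos | auto ]. }
exists (mkposreal _ Hr); intros y Hy.
change (Cmod (y - alpha) < Rmin d (eps / (L * K + 1)))%R in Hy.
change (Cmod (cauchy_moment a b w k y - cauchy_moment a b w k alpha
     - (y - alpha) * (INR k * cauchy_moment a b w (S k) alpha))
   <= eps * Cmod (y - alpha))%R.
pose proof (Rlt_le_trans _ _ _ Hy (Rmin_l _ _)) as Hy1.
pose proof (Rlt_le_trans _ _ _ Hy (Rmin_r _ _)) as Hy2.
eapply Rle_trans; [ now apply Hquad | ].
replace (L * (K * Cmod (y - alpha) ^ 2))%R
  with (L * K * Cmod (y - alpha) * Cmod (y - alpha))%R by ring.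
apply Rmult_le_compat_r; [ apply Cmod_ge_0 | ].
apply (Rmult_lt_compat_l (L * K + 1)) in Hy2; auto.
replace ((L * K + 1) * (eps / (L * K + 1)))%R with (eps : R) in Hy2 by (field; lra).
pose proof (Cmod_ge_0 (y - alpha)); lra.
Qed.

(** * The power function on the cut circle, and the differential equation *)

(** An open window of length [2 PI] meets each point of the circle at most once, so
    the branch of the argument is determined by its defining property. *)
Lemma Cexp_Ci_inj (s t : R) :
  (Rabs (s - t) < 2 * PI)%R -> Cexp (Ci * s) = Cexp (Ci * t) -> s = t.
Proof.
intros Hst E.
assert (E1 : Cexp (Ci * (s - t)%R) = 1).
{ replace (Ci * (s - t)%R) with (Ci * s + - (Ci * t)) by (rewrite RtoC_minus; ring).
  rewrite Cexp_add, E, <- Cexp_add.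
  replace (Ci * t + - (Ci * t)) with (RtoC 0) by ring; apply Cexp_0. }
assert (Hc : cos (s - t) = 1%R).
{ apply (f_equal fst) in E1; unfold Cexp in E1; simpl in E1.
  replace (0 * (s - t) - 1 * 0)%R with 0%R in E1 by ring.
  replace (0 * 0 + 1 * (s - t))%R with (s - t)%R in E1 by ring.
  rewrite exp_0 in E1; lra. }
set (x := ((s - t) / 2)%R).
assert (Hs : sin x = 0%R).
{ replace (s - t)%R with (2 * x)%R in Hc by (unfold x; field).
  rewrite cos_2a_sin in Hc.
  apply Rsqr_0_uniq; unfold Rsqr; lra. }
apply Rabs_def2 in Hst; pose proof PI_RGT_0.
destruct (Rtotal_order x 0) as [Hx | [Hx | Hx]].
- assert (0 < sin (- x))%R by (apply sin_gt_0; unfold x in *; lra).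
  rewrite sin_neg in *; lra.
- unfold x in Hx; lra.
- assert (0 < sin x)%R by (apply sin_gt_0; unfold x in *; lra); lra.
Qed.

Lemma log_branch_circle (theta t : R) :
  (theta - 2 * PI < t < theta)%R -> log_branch theta (Cexp (Ci * t)) = Ci * t.
Proof.
intros Ht; unfold log_branch, arg_branch; rewrite Cmod_Cexp_Ci, ln_1.
rewrite (iota_unique (V := R_CompleteNormedModule) _ t).
- ring.
- intros s [Hs E]; apply Cexp_Ci_inj.
  + apply Rabs_def1; lra.
  + rewrite E; ring.
- split; [ exact Ht | ring ].
Qed.

(** [z ^ beta dz/dt] along the parametrisation [z = e ^ (i t)], the factor
    [z = e ^ (i t)] of [dz/dt] being absorbed in the exponent. *)
Definition power_weight (beta : C) (t : R) : C :=
  Ci * Cexp ((beta + 1) * Ci * t).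

Lemma ex_derive_power_weight (beta : C) (t : R) :
  ex_derive (V := C_R_NormedModule) (power_weight beta) t.
Proof.
apply ex_derive_C_mult.
- apply @ex_derive_const.
- eexists; apply is_derive_Cexp_linear.
Qed.

(** The branch is pinned down only for [t] strictly inside the interval, which
    is all that the Riemann integral sees. *)
Lemma cauchy_power_int_moment (theta : R) (beta alpha : C) :
  cauchy_power_int theta beta alpha =
  cauchy_moment (theta - 2 * PI) theta (power_weight beta) 1 alpha.
Proof.
unfold cauchy_power_int, unit_circle_int, cauchy_moment.
apply (RInt_ext (V := C_R_CompleteNormedModule)); intros t.
pose proof PI_RGT_0; rewrite Rmin_left, Rmax_right by lra; intros Ht.
rewrite log_branch_circle by exact Ht; unfold power_weight.
replace ((beta + 1) * Ci * t) with (beta * (Ci * t) + Ci * t) by ring.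
rewrite Cexp_add; unfold Cdiv; simpl; ring.
Qed.

(** The heart of the differential equation: applied to the kernel
    [z ^ beta / (z - alpha)], the differential operator gives the exact
    [z]-derivative of [z ^ (beta + 1) (z - c) / (z - alpha) ^ 2], where
    [c] stands for [e ^ (i theta)]. *)
Lemma is_derive_power_primitive (c : C) (beta alpha : C) (t : R) :
  (Cmod alpha < 1)%R ->
  is_derive (V := C_R_NormedModule)
    (fun s : R => Cexp ((beta + 1) * Ci * s) * (Cexp (Ci * s) - c)
       * (/ (Cexp (Ci * s) - alpha) * / (Cexp (Ci * s) - alpha))) t
    (let k n := power_weight beta t * (/ (Cexp (Ci * t) - alpha)) ^ n in
     2 * (alpha * c - alpha ^ 2) * k 3%nat
     + ((1 - beta) * c - (2 - beta) * alpha) * k 2%nat + beta * k 1%nat).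
Proof.
intros Ha.
pose proof (is_derive_circle_inv alpha t Ha) as Hinv.
assert (Hsub : is_derive (V := C_R_NormedModule)
  (fun s : R => Cexp (Ci * s) - c) t (Ci * Cexp (Ci * t))).
{ replace (Ci * Cexp (Ci * t)) with (Ci * Cexp (Ci * t) - 0) by ring.
  apply @is_derive_minus; [ apply is_derive_Cexp_linear | apply @is_derive_const ]. }
pose proof (is_derive_C_mult _ _ _ _ _
  (is_derive_C_mult _ _ _ _ _ (is_derive_Cexp_linear ((beta + 1) * Ci) t) Hsub)
  (is_derive_C_mult _ _ _ _ _ Hinv Hinv)) as H.
eapply eq_ind; [ exact H | ].
unfold power_weight; simpl.
pose proof (circle_sub_neq_0 alpha t Ha).
field; auto.
Qed.

(** Both ends of the parameter interval are sent to [e ^ (i theta)], where the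
    factor [z - c] of the primitive vanishes, so the boundary terms disappear
    although [z ^ beta] itself jumps there. *)
Lemma cauchy_moment_ode (theta : R) (beta alpha : C) :
  (Cmod alpha < 1)%R ->
  let M k := cauchy_moment (theta - 2 * PI) theta (power_weight beta) k alpha in
  r2 theta alpha * (2 * M 3%nat) + r1 theta beta alpha * M 2%nat
    + beta * M 1%nat = 0.
Proof.
intros Ha M.
set (a := (theta - 2 * PI)%R) in *; set (c := Cexp (Ci * theta)).
assert (Ec : Cexp (Ci * a) = c).
{ unfold c, a, Cexp; simpl.
  replace (0 * (theta - 2 * PI) - 1 * 0)%R with (0 * theta - 1 * 0)%R by ring.
  replace (0 * theta + 1 * 0)%R with 0%R by ring.
  replace (0 * 0 + 1 * theta)%R with ((theta - 2 * PI) + 2 * PI)%R by ring.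
  replace (0 * 0 + 1 * (theta - 2 * PI))%R with (theta - 2 * PI)%R by ring.
  now rewrite cos_plus, sin_plus, cos_2PI, sin_2PI, !Rmult_1_r, !Rmult_0_r,
    !Rminus_0_r, ?Rplus_0_r. }
pose proof (fun k => is_RInt_cauchy_moment a theta (power_weight beta) k alpha
  (ex_derive_power_weight beta) Ha) as HM.
pose proof (is_RInt_plus _ _ _ _ _ _ (is_RInt_plus _ _ _ _ _ _
  (is_RInt_C_scal (2 * (alpha * c - alpha ^ 2)) _ _ _ _ (HM 3%nat))
  (is_RInt_C_scal ((1 - beta) * c - (2 - beta) * alpha) _ _ _ _ (HM 2%nat)))
  (is_RInt_C_scal beta _ _ _ _ (HM 1%nat))) as H1.
apply (is_RInt_unique (V := C_R_CompleteNormedModule)) in H1.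
assert (H2 := is_RInt_derive (V := C_R_CompleteNormedModule) _ _ a theta
  (fun t _ => is_derive_power_primitive c beta alpha t Ha)).
apply (is_RInt_unique (V := C_R_CompleteNormedModule)) in H2.
- transitivity (RtoC 0 - 0); [ | ring ].
  fold c in H2; rewrite Ec in H2.
  unfold r2, r1; fold c.
  transitivity (2 * (alpha * c - alpha ^ 2) * M 3%nat
    + ((1 - beta) * c - (2 - beta) * alpha) * M 2%nat + beta * M 1%nat); [ ring | ].
  etransitivity; [ symmetry; exact H1 | ].
  etransitivity; [ exact H2 | ].
  change (minus ?x ?y) with (x - y).
  ring.
- intros t _; apply (ex_derive_continuous (V := C_R_NormedModule)).
  assert (Hk : forall (d : C) k, ex_derive (V := C_R_NormedModule)
    (fun s : R => d * (power_weight beta s * (/ (Cexp (Ci * s) - alpha)) ^ k)) t).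
  { intros d k; apply ex_derive_C_mult; [ apply @ex_derive_const | ].
    apply ex_derive_C_mult; [ apply ex_derive_power_weight | ].
    now apply ex_derive_circle_inv_pow. }
  apply @ex_derive_plus; [ apply @ex_derive_plus | ]; apply Hk.
Qed.

(** The second derivative at [z] requires the first one on a neighbourhood of
    [z], hence openness of the disk. *)
Lemma solves_on_disk (theta : R) (beta : C) :
  solves_on (fun alpha : C => (Cmod alpha < 1)%R)
    (r2 theta) (r1 theta beta) (fun _ => beta) (cauchy_power_int theta beta).
Proof.
set (M := cauchy_moment (theta - 2 * PI) theta (power_weight beta)).
assert (HM : forall k z, (Cmod z < 1)%R ->
  is_derive (K := C_AbsRing) (V := C_NormedModule) (M k) z (INR k * M (S k) z)).
{ intros k z Hz; apply is_derive_cauchy_moment; auto using ex_derive_power_weight.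
  pose proof PI_RGT_0; lra. }
assert (D1 : forall z, (Cmod z < 1)%R -> is_derive (K := C_AbsRing)
  (V := C_NormedModule) (cauchy_power_int theta beta) z (M 2%nat z)).
{ intros z Hz; apply (is_derive_ext (M 1%nat)).
  - intros; symmetry; apply cauchy_power_int_moment.
  - replace (M 2%nat z) with (INR 1 * M 2%nat z) by (simpl; ring); auto. }
assert (D2 : forall z, (Cmod z < 1)%R -> is_derive (K := C_AbsRing)
  (V := C_NormedModule) (C_derive (cauchy_power_int theta beta)) z (2 * M 3%nat z)).
{ intros z Hz; apply (is_derive_ext_loc (M 2%nat)).
  - assert (Hr : (0 < 1 - Cmod z)%R) by lra.
    exists (mkposreal _ Hr); intros y Hy; symmetry; apply is_C_derive_unique, D1.
    change (Cmod (y - z) < 1 - Cmod z)%R in Hy.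
    pose proof (Cmod_le_sub_add y z); lra.
  - replace (RtoC 2) with (RtoC (INR 2)) by (simpl; f_equal; ring); auto. }
intros z Hz; split; [ | split ].
- eexists; now apply D1.
- eexists; now apply D2.
- rewrite (is_C_derive_unique _ _ _ (D2 z Hz)), (is_C_derive_unique _ _ _ (D1 z Hz)).
  rewrite cauchy_power_int_moment; exact (cauchy_moment_ode theta beta z Hz).
Qed.

(** * Analyticity and poles *)

(** The topology of [C] is that of a product, with square neighbourhoods; all
    the estimates here use the modulus. *)
Lemma C_locally_iff (a : C) (P : C -> Prop) :
  locally (T := C_UniformSpace) a P <->
  exists r, (0 < r)%R /\ forall z, (Cmod (z - a) < r)%R -> P z.
Proof.
rewrite locally_C; split.
- intros [r Hr]; exists r; split; [ apply cond_pos | exact Hr ].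
- intros (r & Hr & H); exists (mkposreal r Hr); exact H.
Qed.

(** Identities between rational functions hold away from finitely many points;
    near [a] only one such exceptional point [c] ever has to be kept out. *)
Lemma locally'_avoid (a c : C) (P : C -> Prop) :
  c <> a -> (forall z, z <> a -> z <> c -> P z) ->
  locally' (T := C_UniformSpace) a P.
Proof.
intros Hc H; apply C_locally_iff.
exists (Cmod (c - a)); split; [ apply Cmod_gt_0, Cminus_eq_contra, Hc | ].
intros z Hz Hza; apply H; auto; intros ->; lra.
Qed.

(** Geometric series in [(z - a) / (c - a)], of radius [|c - a|]. *)
Lemma analytic_at_moebius (A B c a : C) :
  c <> a -> analytic_at (fun z => A + B / (c - z)) a.
Proof.
intros Hc; pose proof (Cminus_eq_contra _ _ Hc) as Hca.
exists (fun n => (match n with O => A | _ => 0 end) + B * (/ (c - a)) ^ S n).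
apply C_locally_iff; exists (Cmod (c - a)); split; [ now apply Cmod_gt_0 | ].
intros z Hz.
assert (Hcz : c - z <> 0).
{ intros E; replace (z - a) with (c - a - (c - z)) in Hz by ring.
  rewrite E in Hz; replace (c - a - 0) with (c - a) in Hz by ring; lra. }
set (q := (z - a) / (c - a)).
assert (Hq : (Cmod q < 1)%R).
{ unfold q; rewrite Cmod_div by auto; apply Cmod_gt_0 in Hca.
  apply (Rmult_lt_reg_r (Cmod (c - a))); auto; unfold Rdiv.
  rewrite Rmult_assoc, Rinv_l by lra; lra. }
assert (Hsum : forall N : nat, sum_n (G := C_NormedModule)
  (fun k => scal (pow_n (K := C_AbsRing) (z - a) k)
    ((match k with O => A | _ => 0 end) + B * (/ (c - a)) ^ S k)) N
  = A + B / (c - z) - B / (c - z) * q ^ S N).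
{ induction N as [|N IH].
  - rewrite sum_O; cbv [scal]; simpl; cbv [one mult]; simpl; unfold q; field; auto.
  - rewrite sum_Sn, IH.
    change (A + B / (c - z) - B / (c - z) * q ^ S N
      + (z - a) ^ S N * (0 + B * (/ (c - a)) ^ S (S N))
      = A + B / (c - z) - B / (c - z) * q ^ S (S N)).
    assert (E : (z - a) ^ S N * (/ (c - a)) ^ S N = q ^ S N)
      by (rewrite <- Cpow_mult_l; reflexivity).
    rewrite (Cpow_S (/ (c - a)) (S N)), (Cpow_S q (S N)).
    replace ((z - a) ^ S N * (0 + B * (/ (c - a) * (/ (c - a)) ^ S N)))
      with (B / (c - a) * q ^ S N) by (rewrite <- E; unfold Cdiv; ring).
    unfold q at 3; field; auto. }
apply filterlim_locally_ball_norm; intros eps.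
set (K := Cmod (B / (c - z))).
assert (HK : (0 <= K)%R) by apply Cmod_ge_0.
destruct (pow_lt_1_zero (Cmod q)) with (y := (eps / (K + 1))%R) as [N HN].
- rewrite Rabs_pos_eq; auto using Cmod_ge_0.
- apply Rdiv_lt_0_compat; [ apply cond_pos | lra ].
- exists N; intros n Hn; unfold ball_norm; rewrite Hsum.
  change (Cmod (A + B / (c - z) - B / (c - z) * q ^ S n - (A + B / (c - z))) < eps)%R.
  replace (A + B / (c - z) - B / (c - z) * q ^ S n - (A + B / (c - z)))
    with (- (B / (c - z) * q ^ S n)) by ring.
  rewrite Cmod_opp, Cmod_mult, Cmod_pow; fold K.
  specialize (HN (S n) ltac:(lia)).
  rewrite Rabs_pos_eq in HN by (apply pow_le, Cmod_ge_0).
  apply (Rmult_lt_compat_l (K + 1)) in HN; [ | lra ].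
  replace ((K + 1) * (eps / (K + 1)))%R with (eps : R) in HN by (field; lra).
  assert (0 <= Cmod q ^ S n)%R by (apply pow_le, Cmod_ge_0); lra.
Qed.

(** A power series convergent at [a + s] has terms bounded by some [M] there,
    so for [|z - a| <= s / 2] its tail from order one is dominated by a geometric
    series of ratio at most [1/2] and sum at most [2 M |z - a| / s]. *)
Lemma analytic_at_lipschitz (g : C -> C) (a : C) :
  analytic_at g a ->
  exists K r, (0 < r)%R /\ forall z, (Cmod (z - a) < r)%R ->
    (Cmod (g z - g a) <= K * Cmod (z - a))%R.
Proof.
intros [c Hc]; apply C_locally_iff in Hc; destruct Hc as (r & Hr & Hc).
set (s := (r / 2)%R); assert (Hs : (0 < s)%R) by (unfold s; lra).
assert (Hcs : exists M, forall k, (Cmod (c k) * s ^ k <= M)%R).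
{ specialize (Hc (a + s)).
  replace (a + s - a) with (RtoC s) in Hc by ring.
  rewrite Cmod_R, Rabs_pos_eq in Hc by lra.
  assert (Hcv := Hc ltac:(unfold s; lra)).
  destruct (filterlim_bounded _ (ex_intro _ _ Hcv)) as [M HM].
  set (S0 := sum_n _) in HM; change (forall n, (Cmod (S0 n) <= M)%R) in HM.
  exists (M + M)%R; intros k.
  replace (Cmod (c k) * s ^ k)%R with (Cmod (RtoC s ^ k * c k))
    by (rewrite Cmod_mult, Cmod_pow, Cmod_R, Rabs_pos_eq by lra; ring).
  destruct k as [|k].
  - specialize (HM 0%nat); unfold S0 in HM; rewrite sum_O in HM.
    change (Cmod (RtoC s ^ 0 * c 0%nat) <= M)%R in HM.
    pose proof (Cmod_ge_0 (RtoC s ^ 0 * c 0%nat)); lra.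
  - replace (RtoC s ^ S k * c (S k)) with (S0 (S k) + - S0 k).
    + eapply Rle_trans; [ apply Cmod_triangle | ]; rewrite Cmod_opp.
      apply Rplus_le_compat; apply HM.
    + unfold S0; rewrite sum_Sn.
      set (T := sum_n _ k).
      change (T + RtoC s ^ S k * c (S k) + - T = RtoC s ^ S k * c (S k)); ring. }
destruct Hcs as [M HM].
assert (HM0 : (0 <= M)%R).
{ eapply Rle_trans; [ | apply (HM 0%nat) ]; simpl; rewrite Rmult_1_r; apply Cmod_ge_0. }
assert (Hc0 : forall z, (Cmod (z - a) < s / 2)%R ->
  (Cmod (g z - c 0%nat) <= 2 * M / s * Cmod (z - a))%R).
{ intros z Hz.
  set (rho := (Cmod (z - a) / s)%R).
  assert (Hrho : (0 <= rho <= / 2)%R).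
  { unfold rho; split.
    - apply Rdiv_le_0_compat; auto using Cmod_ge_0.
    - apply Rlt_le, (Rmult_lt_reg_r s); auto; unfold Rdiv.
      rewrite Rmult_assoc, Rinv_l by lra; lra. }
  assert (Hterm : forall k, (Cmod ((z - a) ^ k * c k) <= M * rho ^ k)%R).
  { intros k; rewrite Cmod_mult, Cmod_pow.
    replace (Cmod (z - a)) with (rho * s)%R by (unfold rho; field; lra).
    rewrite Rpow_mult_distr; specialize (HM k).
    apply (Rmult_le_compat_r (rho ^ k)) in HM; [ | now apply pow_le ].
    lra. }
  assert (Hpart : forall N : nat, (Cmod (sum_n (G := C_NormedModule)
    (fun k => scal (pow_n (K := C_AbsRing) (z - a) k) (c k)) N - c 0%nat)%C
    <= 2 * M * rho * (1 - (/ 2) ^ N))%R).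
  { induction N as [|N IH].
    - rewrite sum_O.
      change (Cmod (1 * c 0%nat - c 0%nat) <= 2 * M * rho * (1 - (/ 2) ^ 0))%R.
      replace (1 * c 0%nat - c 0%nat) with (RtoC 0) by ring.
      rewrite Cmod_0; simpl; lra.
    - rewrite sum_Sn.
      set (S0 := sum_n _ N) in *.
      change (Cmod (S0 + (z - a) ^ S N * c (S N) - c 0%nat) <=
        2 * M * rho * (1 - (/ 2) ^ S N))%R.
      replace (S0 + (z - a) ^ S N * c (S N) - c 0%nat)
        with ((S0 - c 0%nat) + (z - a) ^ S N * c (S N)) by ring.
      eapply Rle_trans; [ apply Cmod_triangle | ].
      specialize (Hterm (S N)); simpl in Hterm |- *.
      assert (Hp : (rho ^ N <= (/ 2) ^ N)%R) by (apply pow_incr; lra).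
      apply (Rmult_le_compat_l (M * rho)) in Hp; [ | apply Rmult_le_pos; lra ].
      lra. }
  replace (2 * M / s * Cmod (z - a))%R with (2 * M * rho)%R
    by (unfold rho; field; lra).
  apply le_epsilon; intros eps Heps.
  assert (Hz' : (Cmod (z - a) < r)%R) by (unfold s in Hz; lra).
  specialize (Hc z Hz').
  apply filterlim_locally_ball_norm with (eps := mkposreal eps Heps) in Hc.
  destruct Hc as [N HN]; specialize (HN N (Nat.le_refl N)); specialize (Hpart N).
  set (S0 := sum_n _ N) in *.
  change (Cmod (S0 - g z) < eps)%R in HN.
  assert (HS0 : (Cmod (S0 - c 0%nat) <= 2 * M * rho)%R).
  { eapply Rle_trans; [ exact Hpart | ].
    rewrite <- (Rmult_1_r (2 * M * rho)) at 2; apply Rmult_le_compat_l.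
    - apply Rmult_le_pos; lra.
    - assert (0 <= (/ 2) ^ N)%R by (apply pow_le; lra); lra. }
  replace (g z - c 0%nat) with ((S0 - c 0%nat) + - (S0 - g z)) by ring.
  eapply Rle_trans; [ apply Cmod_triangle | ]; rewrite Cmod_opp; lra. }
assert (Ega : g a = c 0%nat).
{ assert (H0 : (Cmod (a - a) = 0)%R).
  { replace (a - a) with (RtoC 0) by ring; apply Cmod_0. }
  specialize (Hc0 a ltac:(rewrite H0; lra)); rewrite H0, Rmult_0_r in Hc0.
  apply Ceq_minus, Cmod_eq_0, Rle_antisym; auto using Cmod_ge_0. }
exists (2 * M / s)%R, (s / 2)%R; split; [ lra | ].
intros z Hz; rewrite Ega; auto.
Qed.

(** If [f = g / (z - a) ^ n] with [n > 0] and [f] bounded, then [g] tends to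
    [0] at [a]; by continuity [g a = 0], which a pole forbids. *)
Lemma bounded_not_has_pole (f : C -> C) (a : C) (B r : R) :
  (0 < r)%R -> (forall z, (Cmod (z - a) < r)%R -> (Cmod (f z) <= B)%R) ->
  ~ has_pole f a.
Proof.
intros Hr HB (n & g & Hn & Hg & Hga & Hf).
apply analytic_at_lipschitz in Hg; destruct Hg as (K & r1 & Hr1 & HK).
apply C_locally_iff in Hf; destruct Hf as (r2 & Hr2 & Hf).
apply Cmod_gt_0 in Hga.
assert (HB0 : (0 <= B)%R).
{ eapply Rle_trans; [ apply Cmod_ge_0 | apply (HB a) ].
  replace (a - a) with (RtoC 0) by ring; now rewrite Cmod_0. }
(* At distance [t < d] from [a], both [|g|] and its variation are too small:
   [|g a| <= |K| t + B t < |g a|]. *)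
set (d := (Cmod (g a) / (B + Rabs K + 1))%R).
assert (HD : (0 < B + Rabs K + 1)%R) by (pose proof (Rabs_pos K); lra).
assert (Hd : (0 < d)%R) by (apply Rdiv_lt_0_compat; auto).
set (t := (Rmin (Rmin 1 d) (Rmin r (Rmin r1 r2)) / 2)%R).
assert (Ht : (0 < t /\ t < 1 /\ t < d /\ t < r /\ t < r1 /\ t < r2)%R).
{ set (m := Rmin (Rmin 1 d) (Rmin r (Rmin r1 r2))) in *.
  assert (0 < m)%R by (repeat apply Rmin_pos; lra).
  assert (m <= 1 /\ m <= d /\ m <= r /\ m <= r1 /\ m <= r2)%R.
  { unfold m; repeat split;
      repeat (apply Rle_refl || (eapply Rle_trans; [ apply Rmin_l | apply Rle_refl ])
        || (eapply Rle_trans; [ apply Rmin_l | apply Rmin_l ])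
        || (eapply Rle_trans; [ apply Rmin_l | apply Rmin_r ])
        || (eapply Rle_trans; [ apply Rmin_r | ])). }
  unfold t; lra. }
destruct Ht as (Ht & Ht1 & Htd & Htr & Htr1 & Htr2).
assert (Ez : a + t - a = RtoC t) by ring.
assert (Mz : Cmod (a + t - a) = t) by (rewrite Ez, Cmod_R; apply Rabs_pos_eq; lra).
assert (Ht0 : RtoC t <> 0) by (apply Cmod_gt_0; rewrite <- Ez, Mz; exact Ht).
assert (Hgz : (Cmod (g (a + t)%C) <= B * t)%R).
{ assert (E : g (a + t) = f (a + t) * (a + t - a) ^ n).
  { rewrite Hf by (try (rewrite Mz; exact Htr2); intros E; apply Ht0;
      rewrite <- Ez, E; ring).
    field; rewrite Ez; now apply Cpow_nz. }
  rewrite E, Cmod_mult, Cmod_pow, Mz.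
  apply Rmult_le_compat; auto using Cmod_ge_0.
  - apply pow_le; lra.
  - apply HB; rewrite Mz; exact Htr.
  - destruct n as [|n]; [ lia | ]; simpl.
    rewrite <- (Rmult_1_r t) at 3; apply Rmult_le_compat_l; [ lra | ].
    rewrite <- (pow1 n); apply pow_incr; lra. }
specialize (HK (a + t)); rewrite Mz in HK; specialize (HK Htr1).
assert (T : (Cmod (g a) <= Cmod (g a - g (a + t)%C) + Cmod (g (a + t)%C))%R)
  by apply Cmod_le_sub_add.
rewrite <- Cmod_opp in HK.
replace (- (g (a + t) - g a)) with (g a - g (a + t)) in HK by ring.
assert (HKt : (K * t <= Rabs K * t)%R)
  by (apply Rmult_le_compat_r; [ lra | apply Rle_abs ]).
apply (Rmult_lt_compat_l (B + Rabs K + 1)) in Htd; auto.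
unfold d in Htd.
replace ((B + Rabs K + 1) * (Cmod (g a) / (B + Rabs K + 1)))%R
  with (Cmod (g a)) in Htd by (field; lra).
lra.
Qed.

(** * The singular points of the equation *)

Lemma Cmod_inv_sub_bound (c a z : C) :
  c <> a -> (Cmod (z - a) < Cmod (c - a) / 2)%R ->
  c - z <> 0 /\ (Cmod (/ (c - z)) <= 2 / Cmod (c - a))%R.
Proof.
intros Hc Hz; apply Cminus_eq_contra, Cmod_gt_0 in Hc.
assert (H : (Cmod (c - a) / 2 < Cmod (c - z))%R).
{ pose proof (Cmod_le_sub_add (c - a) (z - a)) as T.
  replace (c - a - (z - a)) with (c - z) in T by ring; lra. }
assert (Hcz : c - z <> 0) by (apply Cmod_gt_0; lra).
split; [ exact Hcz | ].
rewrite Cmod_inv by exact Hcz.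
replace (2 / Cmod (c - a))%R with (/ (Cmod (c - a) / 2))%R by (field; lra).
apply Rinv_le_contravar; lra.
Qed.

(** Away from its two simple poles [c] and [d] such a function is bounded. *)
Lemma partial_fractions_not_has_pole (f : C -> C) (p q c d a : C) :
  c <> a -> d <> a ->
  (forall z, c - z <> 0 -> d - z <> 0 -> f z = p * / (c - z) + q * / (d - z)) ->
  ~ has_pole f a.
Proof.
intros Hc Hd Hf.
pose proof (proj1 (Cmod_gt_0 _) (Cminus_eq_contra _ _ Hc)) as Hc'.
pose proof (proj1 (Cmod_gt_0 _) (Cminus_eq_contra _ _ Hd)) as Hd'.
apply (bounded_not_has_pole f a
  (Cmod p * (2 / Cmod (c - a)) + Cmod q * (2 / Cmod (d - a)))%R
  (Rmin (Cmod (c - a) / 2) (Cmod (d - a) / 2))%R).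
- apply Rmin_pos; lra.
- intros z Hz.
  destruct (Cmod_inv_sub_bound c a z Hc) as [Hcz Bc];
    [ eapply Rlt_le_trans; [ exact Hz | apply Rmin_l ] | ].
  destruct (Cmod_inv_sub_bound d a z Hd) as [Hdz Bd];
    [ eapply Rlt_le_trans; [ exact Hz | apply Rmin_r ] | ].
  rewrite Hf by assumption.
  eapply Rle_trans; [ apply Cmod_triangle | ]; rewrite !Cmod_mult.
  apply Rplus_le_compat; apply Rmult_le_compat_l; auto using Cmod_ge_0.
Qed.

Lemma analytic_near_moebius (f : C -> C) (A B c a : C) :
  c <> a -> (forall z, z <> a -> z <> c -> f z = A + B / (c - z)) ->
  analytic_near f a.
Proof.
intros Hc Hf; exists (fun z => A + B / (c - z)); split.
- now apply analytic_at_moebius.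
- now apply (locally'_avoid a c).
Qed.

Lemma has_pole_moebius (f : C -> C) (n : nat) (B c a : C) :
  (0 < n)%nat -> c <> a -> B <> 0 ->
  (forall z, z <> a -> z <> c -> f z = B / (c - z) / (z - a) ^ n) ->
  has_pole f a.
Proof.
intros Hn Hc HB Hf; exists n, (fun z => 0 + B / (c - z)).
split; [ exact Hn | split; [ now apply analytic_at_moebius | split ] ].
- rewrite Cplus_0_l; intros E; apply HB.
  replace B with (B / (c - a) * (c - a)) by (field; now apply Cminus_eq_contra).
  rewrite E; ring.
- apply (locally'_avoid a c); [ exact Hc | ].
  intros z Hz Hzc; rewrite Cplus_0_l; auto.
Qed.

(** With [c = e ^ (i theta)] one has [P2 = z (c - z)], and both coefficient
    quotients are combinations of [1 / z] and [1 / (c - z)], which settles the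
    points other than [0] and [c]. At [0], [c] and infinity the pole comes from
    [P0 / P2 = beta / (z (c - z))], since [P1 / P2] loses its pole at [0] when
    [beta = 1]; after multiplication by the allowed factors every quotient takes
    the form [A + B / (d - z)] with [d] another point. *)
Lemma regular_singular_iff (theta : R) (beta : C) (p : option C) :
  beta <> 0 ->
  regular_singular (r2 theta) (r1 theta beta) (fun _ => beta) p <->
  p = Some (0 : C) \/ p = Some (Cexp (Ci * theta)) \/ p = None.
Proof.
intros Hb.
unfold regular_singular, infinity_regular_singular, finite_regular_singular, r2, r1.
assert (Hc : Cexp (Ci * theta) <> 0).
{ apply Cmod_gt_0; rewrite Cmod_Cexp_Ci; lra. }
set (c := Cexp (Ci * theta)) in *; clearbody c.
assert (Hr2 : forall z : C, z * c - z ^ 2 = z * (c - z)) by (intros; ring).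
assert (Hsub : forall z : C, z <> c -> c - z <> 0)
  by (intros; apply Cminus_eq_contra; auto).
split.
- destruct p as [a|]; [ | auto ].
  intros [Hpole _].
  destruct (Ceq_dec a 0) as [->|Ha0]; [ auto | ].
  destruct (Ceq_dec a c) as [->|Hac]; [ auto | ].
  exfalso.
  assert (Hz : forall z : C, 0 - z <> 0 -> z <> 0).
  { intros z H ->; apply H; ring. }
  destruct Hpole as [H|H]; revert H.
  + apply (partial_fractions_not_has_pole _ (- (1 - beta)) (- (1)) 0 c a); auto.
    intros z Hz0 Hzc; rewrite Hr2; field; auto.
  + apply (partial_fractions_not_has_pole _ (- (beta / c)) (beta / c) 0 c a); auto.
    intros z Hz0 Hzc; rewrite Hr2; field; auto.
- assert (Hz : forall z : C, z <> 0 -> 0 - z <> 0).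
  { intros z H E; apply H; replace z with (- (0 - z)) by ring; rewrite E; ring. }
  intros [-> | [-> | ->]].
  + split; [ right; apply (has_pole_moebius _ 1 beta c); auto | split ].
    * intros z Hz0 Hzc; rewrite Hr2; field; auto.
    * apply (analytic_near_moebius _ (2 - beta) (- c) c); auto.
      intros z Hz0 Hzc; rewrite Hr2; field; auto.
    * apply (analytic_near_moebius _ (- beta) (beta * c) c); auto.
      intros z Hz0 Hzc; rewrite Hr2; field; auto.
  + assert (Hsub' : forall z : C, z <> c -> z - c <> 0)
      by (intros; apply Cminus_eq_contra; auto).
    split; [ right; apply (has_pole_moebius _ 1 beta 0); auto | split ].
    * intros z Hzc Hz0; rewrite Hr2; field; auto.
    * apply (analytic_near_moebius _ (2 - beta) ((1 - beta) * c) 0); auto.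
      intros z Hzc Hz0; rewrite Hr2; field; auto.
    * apply (analytic_near_moebius _ (- beta) (- (beta * c)) 0); auto.
      intros z Hzc Hz0; rewrite Hr2; field; auto.
  + assert (Hd : / c <> 0).
    { intros E; apply Hc; replace c with (c * c * / c) by (field; auto).
      rewrite E; ring. }
    (* In the coordinate [x = 1 / z] the leading coefficient is
       [x ^ 2 (c x - 1)], whose other zero is [x = 1 / c]. *)
    assert (Hlead : forall z : C, z <> 0 ->
      z ^ 4 * (/ z * c - (/ z) ^ 2) = z ^ 2 * (c * z - 1)).
    { intros z Hz0; field; auto. }
    assert (Hcz : forall z : C, z <> / c -> c * z - 1 <> 0).
    { intros z Hzd E; apply Hzd; replace z with ((c * z - 1 + 1) / c) by (field; auto).
      rewrite E; field; auto. }
    assert (Hcz' : forall z : C, z <> / c -> 1 - z * c <> 0).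
    { intros z Hzd E; apply (Hcz z Hzd); replace (c * z - 1) with (- (1 - z * c)) by ring.
      rewrite E; ring. }
    split; [ right; apply (has_pole_moebius _ 2 (- (beta / c)) (/ c)); auto | split ].
    * intros E; apply Hb; replace beta with (- - (beta / c) * c) by (field; auto).
      rewrite E; ring.
    * intros z Hz0 Hzd; rewrite Hlead by auto; field; repeat split; auto.
    * apply (analytic_near_moebius _ (1 + beta) (- / c) (/ c)); auto.
      intros z Hz0 Hzd; rewrite Hlead by auto; field; repeat split; auto.
    * apply (analytic_near_moebius _ 0 (- (beta / c)) (/ c)); auto.
      intros z Hz0 Hzd; rewrite Hlead by auto; field; repeat split; auto.
Qed.

Theorem mainTheorem4 (theta : R) (beta : C)
  (htheta : (0 < theta < 2 * PI)%R)
  (hbeta : forall n : nat, beta <> INR n) :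
  solves_on (fun alpha : C => (Cmod alpha < 1)%R)
    (r2 theta) (r1 theta beta) (fun _ => beta)
    (cauchy_power_int theta beta)
  /\
  (forall p : option C,
    regular_singular (r2 theta) (r1 theta beta) (fun _ => beta) p <->
    p = Some (0 : C) \/ p = Some (Cexp (Ci * theta)) \/ p = None).
Proof.
split.
- apply solves_on_disk.
- intros p; apply regular_singular_iff; exact (hbeta 0%nat).
Qed.
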